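(* Let $e_i$ denote the $i$th standard basis vector in $\mathbb{R}^d$ and let $S = \{ \pm e_1, \dots, \pm e_d \} \cup \{0\}$ (a set of $2d+1$ vectors). Let $C \ge 1$ and let $f: S \rightarrow \mathbb{R}^m$ be an arbitrary mapping satisfying \[ 0.9 \|x-y\|_{\infty} \le \|f(x) - f(y)\|_{\infty} \le 1.1 \|x-y\|_{\infty} \quad \text{for all } x,y \in S, \] \[ \|x+y\|_{\infty} \le \|f(x) + f(y)\|_{\infty} \le C \|x+y\|_{\infty} \quad \text{for all } x,y \in S. \] Then $m \ge d$. *)

(* Defs.v *)
From mathcomp Require Import all_boot all_order all_algebra.
From mathcomp Require Import all_classical all_reals all_analysis.

Set Implicit Arguments.
Unset Strict Implicit.
Unset Printing Implicit Defensive.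

Import Order.TTheory GRing.Theory Num.Theory.
Import numFieldNormedType.Exports.

Local Open Scope classical_set_scope.
Local Open Scope ring_scope.

(* R^d is the row space 'rV[R]_d, whose library norm `|x| is the sup norm
   (mx_normrE).  The vector e_i is delta_mx 0 i. *)
Definition cross_points (R : realType) (d : nat) : set 'rV[R]_d :=
  [set x | (exists i : 'I_d, x = delta_mx 0 i \/ x = - delta_mx 0 i) \/ x = 0].
Arguments cross_points : clear implicits.

(* Main.v *)
Require Import Defs.
From mathcomp Require Import all_boot all_order all_algebra.
From mathcomp Require Import all_classical all_reals all_analysis.
From mathcomp Require Import lra.

Set Implicit Arguments.
Unset Strict Implicit.
Unset Printing Implicit Defensive.

Import Order.TTheory GRing.Theory Num.Theory.
Import numFieldNormedType.Exports.

Local Open Scope classical_set_scope.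
Local Open Scope ring_scope.

(** The bounds at [(x, - x)] force [f (- x) = - f x]. Each [f e_i] has a
    coordinate [k i] of absolute value at least [1]. If [k i = k j] with
    [i <> j], then in this coordinate [f e_i + f e_j] or [f e_i - f e_j] has
    absolute value at least [2], but both have norm at most [1.1]. Hence [k] is
    injective. *)

Lemma row_normE (R : realType) (m : nat) (v : 'rV[R]_m) :
  `|v| = \big[Num.max/0]_ij `|v ij.1 ij.2|.
Proof. exact: mx_normrE. Qed.

Lemma norm_coord_le (R : realType) (m : nat) (v : 'rV[R]_m) (k : 'I_m) :
  `|v 0 k| <= `|v|.
Proof.
rewrite row_normE.
exact: (le_bigmax _ (fun ij : 'I_1 * 'I_m => `|v ij.1 ij.2|) (0, k)).
Qed.

(** The maximum defining the norm starts from the default value [0]; [0 < a] ensures that the bound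
    comes from an actual coordinate, also when [m = 0]. *)
Lemma ex_coord_norm_ge (R : realType) (m : nat) (v : 'rV[R]_m) (a : R) :
  0 < a -> a <= `|v| -> exists k, a <= `|v 0 k|.
Proof.
move=> a0 av; apply/not_existsP => small.
suff : `|v| < a by rewrite ltNge av.
rewrite row_normE; apply: bigmax_lt => // -[i k] _ /=.
by rewrite ord1 ltNge; apply/negP/small.
Qed.

Lemma norm_delta_mx (R : realType) (d : nat) (i : 'I_d) :
  `|delta_mx 0 i : 'rV[R]_d| = 1.
Proof.
apply/le_anti/andP; split.
  rewrite row_normE; apply: bigmax_le => // -[a b] _ /=.
  by rewrite mxE; case: (_ && _); rewrite ?normr1 ?normr0.
have := norm_coord_le (delta_mx 0 i : 'rV[R]_d) i.
by rewrite mxE !eqxx normr1.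
Qed.

(** Each coordinate is a difference of two elements of [{0, 1}]. *)
Lemma norm_delta_mxB_le1 (R : realType) (d : nat) (i j : 'I_d) :
  `|delta_mx 0 i - delta_mx 0 j : 'rV[R]_d| <= 1.
Proof.
rewrite row_normE; apply: bigmax_le => // -[a b] _ /=.
rewrite !mxE; case: (_ && _); case: (_ && _);
  by rewrite ?subrr ?subr0 ?sub0r ?normrN ?normr1 ?normr0.
Qed.

(** The supports are disjoint, so in each coordinate at most one term is nonzero. *)
Lemma norm_delta_mxD_le1 (R : realType) (d : nat) (i j : 'I_d) :
  i != j -> `|delta_mx 0 i + delta_mx 0 j : 'rV[R]_d| <= 1.
Proof.
move=> ij; rewrite row_normE; apply: bigmax_le => // -[a b] _ /=.
rewrite !mxE; have [->|bi] := eqVneq b i.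
  by rewrite (negPf ij) andbF addr0; case: (_ && _); rewrite ?normr1 ?normr0.
by rewrite andbF add0r; case: (_ && _); rewrite ?normr1 ?normr0.
Qed.

Lemma coord_ge1_neq (R : realType) (m : nat) (u v : 'rV[R]_m) (k l : 'I_m) :
  `|u + v| < 2 -> `|u - v| < 2 -> 1 <= `|u 0 k| -> 1 <= `|v 0 l| -> k != l.
Proof.
move=> uDv uBv uk vl; apply/eqP => kl; move: vl; rewrite -{l}kl => vk.
have := le_lt_trans (norm_coord_le (u + v) k) uDv.
have := le_lt_trans (norm_coord_le (u - v) k) uBv.
rewrite !mxE !ltr_norml => /andP[? ?] /andP[? ?].
(* Equal signs contradict the bound on [u + v], opposite signs the one on [u - v]. *)
by move: uk vk; rewrite !ler_normr => /orP[?|?] /orP[?|?]; lra.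
Qed.

Theorem mainTheorem12 (R : realType) (d m : nat) (C : R)
    (f : cross_points R d -> 'rV[R]_m) :
  1 <= C ->
  (forall x y : cross_points R d,
      9 / 10 * `|val x - val y| <= `|f x - f y| <= 11 / 10 * `|val x - val y|) ->
  (forall x y : cross_points R d,
      `|val x + val y| <= `|f x + f y| <= C * `|val x + val y|) ->
  (d <= m)%N.
Proof.
move=> _ fB fD.
have memp i : (delta_mx 0 i : 'rV[R]_d) \in cross_points R d.
  by apply/mem_set; left; exists i; left.
have memn i : (- delta_mx 0 i : 'rV[R]_d) \in cross_points R d.
  by apply/mem_set; left; exists i; right.
pose p i : cross_points R d := SigSub (memp i).
pose n i : cross_points R d := SigSub (memn i).
have fn i : f (n i) = - f (p i).
  (* The upper bound here is [C * 0]. *)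
  have /andP[_] := fD (n i) (p i).
  by rewrite /= addNr normr0 mulr0 normr_le0 addr_eq0 => /eqP.
have /choice[k k1] : forall i, exists k, 1 <= `|f (p i) 0 k|.
  move=> i; apply: ex_coord_norm_ge => //.
  (* On the diagonal the lower bound compares the doubles of [e_i] and [f e_i]; halving gives norm
     at least [1]. *)
  have /andP[+ _] := fD (p i) (p i).
  by rewrite /= -!mulr2n !normrMn norm_delta_mx ler_pMn2r.
have k_inj : injective k.
  move=> i j kij; apply/eqP; apply: contraT => ij.
  have /andP[_ leB] := fB (p i) (p j).
  (* Since [f (n j) = - f (p j)], this difference bound controls the sum [f (p i) + f (p j)]. *)
  have /andP[_ leD] := fB (p i) (n j).
  have := norm_delta_mxB_le1 R i j.
  have := norm_delta_mxD_le1 R ij.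
  move: leB leD; rewrite fn /= !opprK => leB leD dD dB.
  (* Both norms are at most [11 / 10 * 1 < 2]. *)
  have : k i != k j by apply: coord_ge1_neq (k1 i) (k1 j); lra.
  by rewrite kij eqxx.
by have := leq_card k k_inj; rewrite !card_ord.
Qed.
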